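(* Let $f\in L^2(0,t^\ast;H^{-1}(\Omega)^d)$ with $f^{n+1}=f(t^{n+1})\in H^{-1}(\Omega)^d$ for $0\le n\le N-1$. Let $u_h^0\in X_h$ and let $(\hat u_h^{n+1},p_h^{n+1},u_h^{n+1})$, $n=0,\dots,N-1$, be generated by Algorithm 1 (described in the context) with parameters $\nu>0$, $\beta\ge 0$, $\gamma\ge 0$, $\Delta t>0$. Then $$\|u^{N}_{h}\|^{2} + \beta \|\nabla \cdot u^{N}_{h}\|^{2} + \sum_{n=0}^{N-1}\Big(\|\hat{u}^{n+1}_{h} - u^{n+1}_{h}\|^{2} + \|\hat{u}^{n+1}_{h} - u^{n}_{h}\|^{2} + \beta \| \nabla \cdot (u^{n+1}_{h} - u^{n}_{h})\|^{2} \Big) + 2\gamma \Delta t\sum_{n=0}^{N-1}\|\nabla\cdot u_h^{n+1}\|^2 + \nu\Delta t\sum_{n=0}^{N-1}\|\nabla\hat u_h^{n+1}\|^2$$ $$\le \|u^{0}_{h}\|^{2} + \beta \|\nabla \cdot u^{0}_{h}\|^{2} + \frac{\Delta t}{\nu}\sum_{n=0}^{N-1}\|f^{n+1}\|_{-1}^2 .$$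
   Context: $\Omega\subset\mathbb R^d$ ($d=2,3$) is a convex polyhedral domain with piecewise smooth boundary; $(\cdot,\cdot)$ and $\|\cdot\|$ are the $L^2(\Omega)$ inner product and norm (also used for the $H^{-1}$–$H^1_0$ duality pairing); $\|\cdot\|_{-1}$ is the norm of $H^{-1}(\Omega)^d$ dual to $v\mapsto\|\nabla v\|$ on $H_0^1(\Omega)^d$. $X=H^1_0(\Omega)^d$, $Q=L^2_0(\Omega)$ (mean-zero $L^2$ functions). The trilinear form is $b(u,v,w)=\tfrac12(u\cdot\nabla v,w)-\tfrac12(u\cdot\nabla w,v)$. $X_h\subset X$ and $Q_h\subset Q$ are conforming finite element spaces (continuous piecewise polynomials on a quasi-uniform mesh of size $h$) satisfying the discrete inf-sup condition $\inf_{q_h\in Q_h}\sup_{v_h\in X_h}\frac{(q_h,\nabla\cdot v_h)}{\|q_h\|\|\nabla v_h\|}\ge\alpha>0$ with $\alpha$ independent of $h$. Time levels are $t^n=n\Delta t$, $n=0,\dots,N$, $t^\ast=N\Delta t$. Algorithm 1. Step 1: given $u_h^n\in X_h$, find $(\hat u_h^{n+1},p_h^{n+1})\in X_h\times Q_h$ such that $$\Big(\tfrac{\hat u_h^{n+1}-u_h^n}{\Delta t},v_h\Big)+b(u_h^n,\hat u_h^{n+1},v_h)+\nu(\nabla\hat u_h^{n+1},\nabla v_h)-(p_h^{n+1},\nabla\cdot v_h)=(f^{n+1},v_h)\quad\forall v_h\in X_h,$$ $$(\nabla\cdot\hat u_h^{n+1},q_h)=0\quad\forall q_h\in Q_h.$$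 Step 2: given $\hat u_h^{n+1}$, find $u_h^{n+1}\in X_h$ such that $$(u_h^{n+1},v_h)+(\beta+\gamma\Delta t)(\nabla\cdot u_h^{n+1},\nabla\cdot v_h)=(\hat u_h^{n+1},v_h)+\beta(\nabla\cdot u_h^n,\nabla\cdot v_h)\quad\forall v_h\in X_h.$$ *)

(* Defs.v *)
From HB Require Import structures.
From mathcomp Require Import all_boot all_order all_algebra.
From mathcomp Require Import -(notations) mpoly.
From mathcomp Require Import all_classical all_reals all_analysis.

Set Implicit Arguments.
Unset Strict Implicit.
Unset Printing Implicit Defensive.
Import Order.TTheory GRing.Theory Num.Theory.
Import numFieldNormedType.Exports.
Local Open Scope classical_set_scope.
Local Open Scope ring_scope.

Definition rV_display : measure_display -> measure_display.
Proof. exact. Qed.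

Section measurable_rV.
Context {disp : measure_display} {T : measurableType disp} {d : nat}.

Let coord (i : 'I_d) (x : 'rV[T]_d) : T := x ord0 i.

Let rV_set0 : g_sigma_preimage coord set0.
Proof. exact: sigma_algebra0. Qed.

Let rV_setC A : g_sigma_preimage coord A -> g_sigma_preimage coord (~` A).
Proof. exact: sigma_algebraC. Qed.

Let rV_bigcup (F : (set 'rV[T]_d)^nat) :
  (forall i, g_sigma_preimage coord (F i)) ->
  g_sigma_preimage coord (\bigcup_i F i).
Proof. exact: sigma_algebra_bigcup. Qed.

HB.instance Definition _ := @isMeasurable.Build (rV_display disp)
  'rV[T]_d (g_sigma_preimage coord) rV_set0 rV_setC rV_bigcup.

Lemma measurable_coord (i : 'I_d) :
  measurable_fun setT (fun x : 'rV[T]_d => x ord0 i).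
Proof.
move=> _ Y mY; rewrite setTI; apply: sub_sigma_algebra => /=.
rewrite -bigcup_seq/=; exists i => /=; first by rewrite mem_index_enum.
by exists Y => //; rewrite setTI.
Qed.

End measurable_rV.

Lemma measurable_fun_rVP {d1 d2} {T1 : measurableType d1}
    {T2 : measurableType d2} n (f : T1 -> 'rV[T2]_n) :
  (forall i, measurable_fun setT (fun t => f t ord0 i)) ->
  measurable_fun setT f.
Proof.
move=> mf; suff mfS : g_sigma_preimage (fun i t => f t ord0 i) `<=` measurable.
  move=> _ A mA; rewrite setTI; apply: mfS.
  rewrite (g_sigma_preimage_comp (fun i (x : 'rV[T2]_n) => x ord0 i) f).
  by exists A => //; rewrite setTI.
apply: smallest_sub; first exact: sigma_algebra_measurable.
rewrite -bigcup_seq/= => A [i _] [B mB <-]; exact: mf.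
Qed.

Section lebesgue_rV.
Context {R : realType}.

Definition rV_cons d (p : 'rV[R]_d * R) : 'rV[R]_d.+1 := row_mx p.2%:M p.1.

Lemma measurable_rV_cons d : measurable_fun setT (@rV_cons d).
Proof.
apply: measurable_fun_rVP => i.
case: (@split_ordP 1 d i) => j ->.
  apply: (eq_measurable_fun snd) => [p _|]; last exact: measurable_snd.
  by rewrite /rV_cons (@row_mxEl _ 1 1 d) !ord1 mxE eqxx mulr1n.
apply: (eq_measurable_fun ((fun x : 'rV[R]_d => x ord0 j) \o fst)) => [p _|].
  by rewrite /rV_cons (@row_mxEr _ 1 1 d).
exact: measurableT_comp (measurable_coord j) measurable_fst.
Qed.

(* Lebesgue measure on R^d: the d-fold product of the one-dimensional one. *)
Fixpoint lebesgue_rV (d : nat) : set 'rV[R]_d -> \bar R :=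
  match d with
  | 0 => \d_(0 : 'rV[R]_0)
  | d'.+1 => pushforward (@lebesgue_rV d' \x (@lebesgue_measure R))%E
                         (@rV_cons d')
  end.

Lemma lebesgue_rV_is_measure d :
  exists m : {measure set 'rV[R]_d -> \bar R}, @lebesgue_rV d = m.
Proof.
elim: d => [|d [m mE]]; first by exists (\d_(0 : 'rV[R]_0)).
pose m1 : {measure set _ -> \bar R} := (m \x (@lebesgue_measure R))%E.
exists (measure_function_pushforward__canonical__measure_function_Measure
  m1 (@measurable_rV_cons d)).
by rewrite /= mE.
Qed.

Let lebesgue_rV0 d : @lebesgue_rV d set0 = 0%E.
Proof. by have [m ->] := lebesgue_rV_is_measure d; exact: measure0. Qed.

Let lebesgue_rV_ge0 d A : (0 <= @lebesgue_rV d A)%E.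
Proof. by have [m ->] := lebesgue_rV_is_measure d; exact: measure_ge0. Qed.

Let lebesgue_rV_sigma_additive d : semi_sigma_additive (@lebesgue_rV d).
Proof.
by have [m ->] := lebesgue_rV_is_measure d; exact: measure_semi_sigma_additive.
Qed.

HB.instance Definition _ d := isMeasure.Build _ _ _ (@lebesgue_rV d)
  (@lebesgue_rV0 d) (@lebesgue_rV_ge0 d) (@lebesgue_rV_sigma_additive d).

End lebesgue_rV.

Section domain.
Context {R : realType} {d : nat}.
Implicit Types (K : set 'rV[R]_d) (T : set (set 'rV[R]_d)).

Definition edot (x y : 'rV[R]_d) : R := \sum_i x ord0 i * y ord0 i.
Definition enorm (x : 'rV[R]_d) : R := Num.sqrt (edot x x).
Definition diam K : R :=
  sup [set r | exists x y, [/\ K x, K y & r = enorm (x - y)]].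

(* Nonempty bounded open convex polytopes, as intersections of finitely many
   open half-spaces. *)
Definition convex_polyhedral K : Prop :=
  [/\ K !=set0, bounded_set K &
      exists m (a : 'I_m -> 'rV[R]_d) (b : 'I_m -> R),
        K = [set x | forall i, edot (a i) x < b i]].

(* Each cell is given by its interior. *)
Definition quasi_uniform_mesh (Omega : set 'rV[R]_d) (rho h : R) T : Prop :=
  [/\ finite_set T,
      (forall K, T K -> convex_polyhedral K),
      trivIset T id,
      closure Omega = \bigcup_(K in T) closure K &
      [/\ (forall K, T K -> diam K <= h),
          (exists2 K, T K & diam K = h) &
          forall K, T K ->
            exists c, [set x | enorm (x - c) < rho * h] `<=` K]].

Definition piecewise_poly (k : nat) T (g : 'rV[R]_d -> R) : Prop :=
  forall K, T K -> exists p : mpoly d R,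
    (msize p <= k.+1)%N /\
    forall x, K x -> g x = meval (fun i => x ord0 i) p.

End domain.

Section function_spaces.
Context {R : realType} {d : nat} (Omega : set 'rV[R]_d).
Local Notation E := 'rV[R]_d.
Local Notation mu := (@lebesgue_rV R d).
Local Notation "''e_' j" := (delta_mx ord0 j : E) (at level 8, j at level 2).

Definition ip (f g : E -> R) : R := (\int[mu]_(x in Omega) (f x * g x))%R.
Definition nrm (f : E -> R) : R := Num.sqrt (ip f f).

Definition ipM m n (f g : E -> 'M[R]_(m, n)) : R :=
  (\int[mu]_(x in Omega) (\sum_i \sum_j f x i j * g x i j))%R.
Definition nrmM m n (f : E -> 'M[R]_(m, n)) : R := Num.sqrt (ipM f f).

Definition L2 (f : E -> R) : Prop := f \_ Omega \in Lfun mu 2%:E.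
Definition L2M m n (f : E -> 'M[R]_(m, n)) : Prop :=
  forall i j, L2 (fun x => f x i j).
Definition L20 (f : E -> R) : Prop :=
  L2 f /\ (\int[mu]_(x in Omega) f x)%R = 0.

Fixpoint Ck (k : nat) (phi : E -> R) : Prop :=
  continuous phi /\
  match k with
  | 0 => True
  | k'.+1 => forall j, (forall x, derivable phi x 'e_j) /\
                       Ck k' (fun x => 'D_('e_j) phi x)
  end.

Definition test_function (phi : E -> R) : Prop :=
  [/\ forall k, Ck k phi,
      compact (closure [set x | phi x != 0]) &
      closure [set x | phi x != 0] `<=` Omega].

(* A Sobolev vector field is represented by the pair (v, G) of the field and
   its weak gradient, G x i j standing for (d v_i / d x_j) (x); G is determined
   by v almost everywhere in Omega. *)
Definition vfield : Type := ((E -> 'rV[R]_d) * (E -> 'M[R]_d))%type.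
HB.instance Definition _ := GRing.Lmodule.on vfield.

Definition grad (v : vfield) : E -> 'M[R]_d := v.2.
Definition div (v : vfield) : E -> R := fun x => \tr (grad v x).

Definition weak_gradient (v : E -> 'rV[R]_d) (G : E -> 'M[R]_d) : Prop :=
  forall phi, test_function phi -> forall i j,
    ip (fun x => v x ord0 i) (fun x => 'D_('e_j) phi x) =
    - ip (fun x => G x i j) phi.

Definition H1 (v : vfield) : Prop :=
  [/\ L2M v.1, L2M (grad v) & weak_gradient v.1 (grad v)].

(* H^1_0(Omega)^d: the closure in H^1 of the compactly supported smooth
   fields. *)
Definition H10 : set vfield := [set v | H1 v /\
  exists phi : nat -> 'I_d -> E -> R,
    [/\ forall n i, test_function (phi n i),
        (fun n => nrmM (v.1 - (fun x => \row_i phi n i x))) @ \oo --> 0 &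
        (fun n => nrmM (grad v - (fun x => \matrix_(i, j) 'D_('e_j) (phi n i) x)))
          @ \oo --> 0]].

(* H^{-1}(Omega)^d; boundedness by the gradient norm makes a functional
   insensitive to the choice of representatives in H10. *)
Definition Hm1 : set (vfield -> R) := [set F |
  (forall a v w, H10 v -> H10 w -> F (a *: v + w) = a * F v + F w) /\
  exists C, forall v, H10 v -> `|F v| <= C * nrmM (grad v)].

Definition dual_norm (F : vfield -> R) : R :=
  sup [set r | exists v, [/\ H10 v, nrmM (grad v) != 0 &
                             r = `|F v| / nrmM (grad v)]].

Definition simple_Hm1 (s : R -> vfield -> R) : Prop :=
  exists m (A : 'I_m -> set R) (F : 'I_m -> vfield -> R),
    (forall i, measurable (A i) /\ Hm1 (F i)) /\
    s = fun t => \sum_i (\1_(A i) t : R) *: F i.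

(* The Bochner space L^2(0, T; H^{-1}(Omega)^d). *)
Definition L2_Hm1 (T : R) (f : R -> vfield -> R) : Prop :=
  [/\ {ae @lebesgue_measure R, forall t, `]0, T[%classic t -> Hm1 (f t)},
      (exists s : nat -> R -> vfield -> R, (forall k, simple_Hm1 (s k)) /\
         {ae @lebesgue_measure R, forall t, `]0, T[%classic t ->
            (fun k => dual_norm (f t - s k t)) @ \oo --> 0}) &
      (\int[@lebesgue_measure R]_(t in `]0%R, T[) (dual_norm (f t) ^+ 2)%:E
         < +oo)%E].

(* ((u . grad) v)_i = sum_j u_j d_j v_i *)
Definition convect (u v : vfield) : E -> 'rV[R]_d :=
  fun x => u.1 x *m (grad v x)^T.

Definition trilinear (u v w : vfield) : R :=
  2^-1 * ipM (convect u v) w.1 - 2^-1 * ipM (convect u w) v.1.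

Definition subspace (V : lmodType R) (S : set V) : Prop :=
  S 0 /\ forall a v w, S v -> S w -> S (a *: v + w).

Definition velocity_space k (T : set (set E)) (X : set vfield) : Prop :=
  [/\ subspace X, X `<=` H10 &
      forall v, X v -> forall i,
        {within closure Omega, continuous (fun x => v.1 x ord0 i)} /\
        piecewise_poly k T (fun x => v.1 x ord0 i)].

Definition pressure_space k (T : set (set E)) (Q : set (E -> R)) : Prop :=
  [/\ subspace (Q : set (E -> R)), Q `<=` L20 &
      forall q, Q q ->
        {within closure Omega, continuous q} /\ piecewise_poly k T q].

Definition inf_sup (alpha : R) (X : set vfield) (Q : set (E -> R)) : Prop :=
  (alpha%:E <= ereal_inf
    [set ereal_sup
           [set (ip q (div v) / (nrm q * nrmM (grad v)))%R%:E
             | v in [set v | X v /\ nrmM (grad v) != 0%R]]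
      | q in [set q | Q q /\ nrm q != 0%R]])%E.

(* hs is the set of mesh sizes; the polynomial degree k, the quasi-uniformity
   constant rho and the inf-sup constant alpha do not depend on h. *)
Definition fe_family (k : nat) (rho alpha : R) (hs : set R)
    (Th : R -> set (set E)) (Xh : R -> set vfield) (Qh : R -> set (E -> R)) :=
  forall h, hs h ->
    [/\ 0 < h, quasi_uniform_mesh Omega rho h (Th h),
        velocity_space k (Th h) (Xh h), pressure_space k (Th h) (Qh h) &
        inf_sup alpha (Xh h) (Qh h)].

Definition step1 (X : set vfield) (Q : set (E -> R)) (nu dt : R)
    (F : vfield -> R) (u uhat : vfield) (p : E -> R) : Prop :=
  [/\ X uhat, Q p,
      (forall v, X v ->
         ipM (dt^-1 *: (uhat - u)).1 v.1 + trilinear u uhat v +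
         nu * ipM (grad uhat) (grad v) - ip p (div v) = F v) &
      (forall q, Q q -> ip (div uhat) q = 0)].

Definition step2 (X : set vfield) (beta gamma dt : R)
    (u uhat u' : vfield) : Prop :=
  X u' /\
  forall v, X v ->
    ipM u'.1 v.1 + (beta + gamma * dt) * ip (div u') (div v) =
    ipM uhat.1 v.1 + beta * ip (div u) (div v).

Definition algorithm1 (X : set vfield) (Q : set (E -> R))
    (nu beta gamma dt : R) (N : nat) (f : R -> vfield -> R)
    (u uhat : nat -> vfield) (p : nat -> E -> R) : Prop :=
  X (u 0) /\
  forall n, (n < N)%N ->
    step1 X Q nu dt (f (n.+1%:R * dt)) (u n) (uhat n.+1) (p n.+1) /\
    step2 X beta gamma dt (u n) (uhat n.+1) (u n.+1).

End function_spaces.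
Arguments vfield : clear implicits.

(* Main.v *)
Require Import Defs.
From mathcomp Require Import all_boot all_order all_algebra.
From mathcomp Require Import all_classical all_reals all_analysis.
From mathcomp Require Import ring lra.
Set Implicit Arguments.
Unset Strict Implicit.
Unset Printing Implicit Defensive.
Import Order.TTheory GRing.Theory Num.Theory.
Import numFieldNormedType.Exports.
Local Open Scope classical_set_scope.
Local Open Scope ring_scope.

(** The estimate is the discrete energy balance of the two steps of the
    algorithm, each tested with its own solution.

    Step 1 tested with the intermediate velocity: the convection term vanishes
    because [trilinear] is skew in its last two arguments, and the pressure term
    vanishes because the intermediate velocity is discretely divergence free.
    The time difference is turned into a difference of squares by the
    polarization identity
      2 (a, b) = |a|^2 + |b|^2 - |a - b|^2,
    and the load is bounded by the dual norm and split by Young's inequality so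
    that exactly half of the viscous dissipation 2 nu dt |grad uhat|^2 is
    absorbed ([step1_energy]).

    Step 2 tested with the new velocity: polarization of both the velocity and
    the divergence products gives an exact balance ([step2_energy]).

    Adding the two cancels |uhat^(n+1)|^2 and leaves
      E^(n+1) + (dissipation in step n) <= E^n + dt / nu |f^(n+1)|_(-1)^2,
    with E^n = |u^n|^2 + beta |div u^n|^2 ([step_energy]), which telescopes.

    The remaining work is to justify the algebra of the inner products: since
    they are integrals, which are additive only on integrable functions, each
    linearity step uses that products of square-integrable functions are
    integrable. *)

(** * The inner product of scalar functions *)

Section L2_scalar.
Context {R : realType} {d : nat} (Omega : set 'rV[R]_d).
Implicit Types f g h : 'rV[R]_d -> R.
Local Notation mu := (@lebesgue_rV R d).

(** Square integrability on Omega is expressed through extension by zero, so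
    the inner product is moved to the whole space, where the theory of L^p spaces
    applies to the extended functions. *)
Lemma ip_restrict f g :
  ip Omega f g = (\int[mu]_x ((f \_ Omega) x * (g \_ Omega) x))%R.
Proof.
rewrite /ip Rintegral_mkcond; apply: eq_Rintegral => x _.
by rewrite /patch; case: ifP => // _; rewrite mulr0.
Qed.

Lemma ipC f g : ip Omega f g = ip Omega g f.
Proof. by apply: eq_Rintegral => x _; rewrite mulrC. Qed.

Lemma L2_mul_integrable f g : L2 Omega f -> L2 Omega g ->
  mu.-integrable setT (EFin \o (fun x => (f \_ Omega) x * (g \_ Omega) x)).
Proof. by move=> f2 g2; apply/Lfun1_integrable; exact: Lfun2_mul_Lfun1. Qed.

Lemma L2_lincomb a f g :
  L2 Omega f -> L2 Omega g -> L2 Omega (fun x => a * f x + g x).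
Proof.
move=> f2 g2; rewrite /L2.
have le12 : (1 <= 2%:E :> \bar R)%E by rewrite lee_fin ler1n.
have -> : (fun x => a * f x + g x) \_ Omega = a *: (f \_ Omega) + g \_ Omega.
  apply/funext => x; rewrite [RHS]/(a * (f \_ Omega) x + (g \_ Omega) x) /patch.
  by case: ifP => //= _; rewrite mulr0; exact/esym/add0r.
by have [_] := Lfun_submod_closed mu le12; apply.
Qed.

Lemma L2_zero : L2 Omega (fun=> 0).
Proof.
have le12 : (1 <= 2%:E :> \bar R)%E by rewrite lee_fin ler1n.
rewrite /L2 (_ : _ \_ Omega = 0); first by have [] := Lfun_addr_closed mu le12.
by apply/funext => x; rewrite /patch; case: ifP.
Qed.

Lemma ip_lincombl a f g h : L2 Omega f -> L2 Omega g -> L2 Omega h ->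
  ip Omega (fun x => a * f x + g x) h = a * ip Omega f h + ip Omega g h.
Proof.
move=> f2 g2 h2; rewrite !ip_restrict.
have fh := L2_mul_integrable f2 h2; have gh := L2_mul_integrable g2 h2.
rewrite -RintegralZl// -RintegralD//; last first.
  by have := integrableZl measurableT a fh; exact: eq_integrable.
apply: eq_Rintegral => x _; rewrite /patch.
by case: ifP => _; [rewrite mulrDl mulrA | rewrite !mulr0; exact/esym/add0r].
Qed.

Lemma L2_sub f g : L2 Omega f -> L2 Omega g -> L2 Omega (f \- g).
Proof.
move=> f2 g2; rewrite (_ : f \- g = fun x => -1 * g x + f x).
  exact: L2_lincomb.
by apply/funext => x /=; rewrite mulN1r addrC.
Qed.

Lemma ip_subl f g h : L2 Omega f -> L2 Omega g -> L2 Omega h ->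
  ip Omega (f \- g) h = ip Omega f h - ip Omega g h.
Proof.
move=> f2 g2 h2; rewrite (_ : f \- g = fun x => -1 * g x + f x).
  by rewrite ip_lincombl// mulN1r addrC.
by apply/funext => x /=; rewrite mulN1r addrC.
Qed.

Lemma sqr_nrm f : nrm Omega f ^+ 2 = ip Omega f f.
Proof.
by rewrite sqr_sqrtr//; apply: Rintegral_ge0 => x _; rewrite -expr2 sqr_ge0.
Qed.

(** With f the new and g the old value of a quantity, this is what turns the
    product of a time difference with the new value into a telescoping
    difference of squares plus a numerical dissipation. *)
Lemma ip_polarization f g : L2 Omega f -> L2 Omega g ->
  2 * ip Omega f g =
  nrm Omega f ^+ 2 + nrm Omega g ^+ 2 - nrm Omega (f \- g) ^+ 2.
Proof.
move=> f2 g2; have fg2 := L2_sub f2 g2; rewrite !sqr_nrm ip_subl//.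
rewrite (ipC f (f \- g)) (ipC g (f \- g)) !ip_subl// (ipC g f).
ring.
Qed.

End L2_scalar.

(** * The inner product of matrix-valued functions *)

Section L2_matrix.
Context {R : realType} {d : nat} (Omega : set 'rV[R]_d) {m n : nat}.
Implicit Types F G H : 'rV[R]_d -> 'M[R]_(m, n).

Lemma ipMC F G : ipM Omega F G = ipM Omega G F.
Proof.
apply: eq_Rintegral => x _; apply: eq_bigr => i _; apply: eq_bigr => j _.
exact: mulrC.
Qed.

(** Entrywise reduction, through which bilinearity is inherited from the scalar
    product; swapping the integral with the sums needs every entry product to be
    integrable. *)
Lemma ipM_sum_ip F G : L2M Omega F -> L2M Omega G ->
  ipM Omega F G =
  \sum_i \sum_j ip Omega (fun x => F x i j) (fun x => G x i j).
Proof.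
move=> F2 G2; rewrite pair_big /=.
have int (k : 'I_m * 'I_n) := L2_mul_integrable (F2 k.1 k.2) (G2 k.1 k.2).
under eq_bigr do rewrite ip_restrict.
rewrite /ipM Rintegral_mkcond /Rintegral sum_fine; last first.
  by move=> k _; exact: integrable_fin_num (int k).
rewrite -integral_sum//; congr fine; apply: eq_integral => x _.
rewrite sumEFin /patch; case: ifP => _; first by rewrite pair_big.
by rewrite big1// => k _; rewrite mulr0.
Qed.

Lemma L2M_sub F G : L2M Omega F -> L2M Omega G -> L2M Omega (F - G).
Proof.
move=> F2 G2 i j; have := L2_sub (F2 i j) (G2 i j); congr L2.
by apply/funext => x; rewrite !mxE.
Qed.

Lemma ipM_subl F G H : L2M Omega F -> L2M Omega G -> L2M Omega H ->
  ipM Omega (F - G) H = ipM Omega F H - ipM Omega G H.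
Proof.
move=> F2 G2 H2; rewrite !ipM_sum_ip//; last exact: L2M_sub.
rewrite -sumrB; apply: eq_bigr => i _; rewrite -sumrB; apply: eq_bigr => j _.
rewrite -ip_subl//; congr ip.
by apply/funext => x; rewrite !mxE.
Qed.

Lemma ipM_scalel a F G : L2M Omega F -> L2M Omega G ->
  ipM Omega (a *: F) G = a * ipM Omega F G.
Proof.
move=> F2 G2; rewrite [in RHS]ipM_sum_ip// mulr_sumr.
have aFE i j : (fun x => (a *: F) x i j) = fun x => a * F x i j + 0.
  by apply/funext => x; rewrite !mxE addr0.
rewrite ipM_sum_ip//; last first.
  by move=> i j; rewrite aFE; apply: L2_lincomb => //; exact: L2_zero.
apply: eq_bigr => i _; rewrite mulr_sumr; apply: eq_bigr => j _.
rewrite aFE ip_lincombl//; last exact: L2_zero.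
rewrite [X in _ + X](_ : _ = 0) ?addr0//.
by rewrite /ip /Rintegral integral0_eq//= => x _; rewrite mul0r.
Qed.

Lemma sqr_nrmM F : nrmM Omega F ^+ 2 = ipM Omega F F.
Proof.
rewrite sqr_sqrtr//; apply: Rintegral_ge0 => x _.
by apply: sumr_ge0 => i _; apply: sumr_ge0 => j _; rewrite -expr2 sqr_ge0.
Qed.

Lemma ipM_polarization F G : L2M Omega F -> L2M Omega G ->
  2 * ipM Omega F G =
  nrmM Omega F ^+ 2 + nrmM Omega G ^+ 2 - nrmM Omega (F - G) ^+ 2.
Proof.
move=> F2 G2; have FG2 := L2M_sub F2 G2; rewrite !sqr_nrmM ipM_subl//.
rewrite (ipMC F (F - G)) (ipMC G (F - G)) !ipM_subl// (ipMC G F).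
ring.
Qed.

End L2_matrix.

(** * Energy balance of one time step *)

Section velocity_fields.
Context {R : realType} {d : nat} (Omega : set 'rV[R]_d).
Implicit Types v w : vfield R d.

Lemma L2_div v : L2M Omega (grad v) -> L2 Omega (div v).
Proof.
move=> v2; rewrite /div /mxtrace.
elim: (index_enum 'I_d) => [|i s IHs].
  by under [X in L2 _ X]eq_fun do rewrite big_nil; exact: L2_zero.
under [X in L2 _ X]eq_fun do rewrite big_cons -[_ i i]mul1r.
exact: L2_lincomb.
Qed.

Lemma div_sub v w : div (v - w) = div v \- div w.
Proof. by apply/funext => x; exact: raddfB (grad v x) (grad w x). Qed.

Lemma trilinear_skew u v : trilinear Omega u v v = 0.
Proof. exact: subrr. Qed.

(** When the gradient norm vanishes the quotient in [dual_norm] says nothing,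
    but then boundedness of F forces F v = 0; otherwise boundedness makes the
    supremum an upper bound. *)
Lemma dual_norm_ge F v : Hm1 Omega F -> H10 Omega v ->
  F v <= dual_norm Omega F * nrmM Omega (grad v).
Proof.
move=> [_ [C FC]] v0; have [g0|gN0] := eqVneq (nrmM Omega (grad v)) 0.
  by have := FC v v0; rewrite g0 !mulr0; exact: le_trans (ler_norm _).
have g_gt0 w : nrmM Omega (grad w) != 0 -> 0 < nrmM Omega (grad w).
  by move=> wN0; rewrite lt_neqAle eq_sym wN0 sqrtr_ge0.
rewrite -ler_pdivrMr ?g_gt0//.
apply: (@le_trans _ _ (`|F v| / nrmM Omega (grad v))).
  by rewrite ler_pM2r ?invr_gt0 ?g_gt0// ler_norm.
apply: ub_le_sup; last by exists v.
by exists C => _ [w [w0 wN0 ->]]; rewrite ler_pdivrMr ?g_gt0//; exact: FC.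
Qed.

(** The momentum equation tested with uhat and multiplied by 2 dt. The
    coefficient of the gradient term is nu dt rather than 2 nu dt, because the
    other half absorbs the load. *)
Lemma step1_energy (X : set (vfield R d)) Q nu dt F u uhat p :
  0 < nu -> 0 < dt -> X `<=` H10 Omega -> Hm1 Omega F -> X u ->
  step1 Omega X Q nu dt F u uhat p ->
  nrmM Omega uhat.1 ^+ 2 + nrmM Omega (uhat - u).1 ^+ 2
    + nu * dt * nrmM Omega (grad uhat) ^+ 2
  <= nrmM Omega u.1 ^+ 2 + dt / nu * dual_norm Omega F ^+ 2.
Proof.
move=> nu0 dt0 XH FH Xu [Xuh Qp eq_mom eq_div].
have [[u2 _ _] _] := XH _ Xu; have [[uh2 _ _] _] := XH _ Xuh.
have := eq_mom _ Xuh; rewrite trilinear_skew addr0 ipC eq_div// subr0.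
rewrite -[(dt^-1 *: (uhat - u)).1]/(dt^-1 *: (uhat.1 - u.1)).
rewrite ipM_scalel//; last exact: L2M_sub.
rewrite ipM_subl// -!sqr_nrmM ipMC => mom.
have pol := ipM_polarization uh2 u2.
have FD := dual_norm_ge FH (XH _ Xuh).
rewrite -[(uhat - u).1]/(uhat.1 - u.1).
set a := nrmM _ uhat.1 ^+ 2 in mom pol *.
set b := nrmM _ u.1 ^+ 2 in pol *.
set c := nrmM _ (_ - _) ^+ 2 in pol *.
set i := ipM _ _ _ in mom pol.
set D := dual_norm _ _ in FD *; set g := nrmM _ (grad _) in mom FD *.
have {}mom : 2 * (a - i) = 2 * dt * (F uhat - nu * g ^+ 2).
  by rewrite -mom; field; rewrite gt_eqF.
(* Weighted by nu so that the gradient term matches the viscous term. *)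
have young : 2 * (D * g) <= nu * g ^+ 2 + D ^+ 2 / nu.
  rewrite -subr_ge0 (_ : _ - _ = (nu * g - D) ^+ 2 / nu).
    by rewrite divr_ge0 ?sqr_ge0// ltW.
  by field; rewrite gt_eqF.
have : dt * (2 * F uhat) <= dt * (nu * g ^+ 2 + D ^+ 2 / nu).
  by rewrite ler_pM2l//; lra.
rewrite (_ : dt / nu * D ^+ 2 = dt * (D ^+ 2 / nu)); last by ring.
move: pol mom; lra.
Qed.

(** The correction equation tested with u', multiplied by 2. Nothing is estimated,
    so this is an equality: |uhat - u'| and beta |div (u' - u)| are the
    polarization defects of its two inner products. *)
Lemma step2_energy (X : set (vfield R d)) beta gamma dt u uhat u' :
  X `<=` H10 Omega -> X u -> X uhat ->
  step2 Omega X beta gamma dt u uhat u' ->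
  nrmM Omega u'.1 ^+ 2 + beta * nrm Omega (div u') ^+ 2
    + nrmM Omega (uhat - u').1 ^+ 2
    + beta * nrm Omega (div (u' - u)) ^+ 2
    + 2 * gamma * dt * nrm Omega (div u') ^+ 2
  = nrmM Omega uhat.1 ^+ 2 + beta * nrm Omega (div u) ^+ 2.
Proof.
move=> XH Xu Xuh [Xu' eq_proj].
have [[uh2 _ _] _] := XH _ Xuh.
have [[_ Gu2 _] _] := XH _ Xu; have [[u'2 Gu'2 _] _] := XH _ Xu'.
have := eq_proj _ Xu'; rewrite -sqr_nrmM -sqr_nrm ipC div_sub.
rewrite -[(uhat - u').1]/(uhat.1 - u'.1).
have := ipM_polarization uh2 u'2.
(* beta times the polarization identity, which leaves a linear goal. *)
have /(congr1 ( *%R beta)) := ip_polarization (L2_div Gu'2) (L2_div Gu2).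
lra.
Qed.

Lemma step_energy (X : set (vfield R d)) Q nu beta gamma dt F u uhat u' p :
  0 < nu -> 0 < dt -> X `<=` H10 Omega -> Hm1 Omega F -> X u ->
  step1 Omega X Q nu dt F u uhat p ->
  step2 Omega X beta gamma dt u uhat u' ->
  nrmM Omega u'.1 ^+ 2 + beta * nrm Omega (div u') ^+ 2
  + (nrmM Omega (uhat - u').1 ^+ 2 + nrmM Omega (uhat - u).1 ^+ 2
     + beta * nrm Omega (div (u' - u)) ^+ 2
     + 2 * gamma * dt * nrm Omega (div u') ^+ 2
     + nu * dt * nrmM Omega (grad uhat) ^+ 2)
  <= nrmM Omega u.1 ^+ 2 + beta * nrm Omega (div u) ^+ 2
     + dt / nu * dual_norm Omega F ^+ 2.
Proof.
move=> nu0 dt0 XH FH Xu s1 s2; have [Xuh _ _ _] := s1.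
have := step1_energy nu0 dt0 XH FH Xu s1; have := step2_energy XH Xu Xuh s2.
lra.
Qed.

End velocity_fields.

(** * Summation over the time steps *)

Lemma telescope_le (R : realType) (a c e : nat -> R) N :
  (forall n, (n < N)%N -> a n.+1 + c n <= a n + e n) ->
  a N + \sum_(0 <= n < N) c n <= a 0%N + \sum_(0 <= n < N) e n.
Proof.
elim: N => [|N IHN] ace; first by rewrite !big_nil.
rewrite !big_nat_recr//=.
have := ace N (ltnSn N); have := IHN (fun n nN => ace n (ltnW nN)).
lra.
Qed.

Theorem theorem4p2 (R : realType) (d : nat) (hd : d = 2%N \/ d = 3%N)
  (Omega : set 'rV[R]_d) (hOmega : convex_polyhedral Omega)
  (k : nat) (rho alpha : R) (hrho : 0 < rho) (halpha : 0 < alpha)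
  (hs : set R) (Th : R -> set (set 'rV[R]_d))
  (Xh : R -> set (vfield R d)) (Qh : R -> set ('rV[R]_d -> R))
  (hfe : fe_family Omega k rho alpha hs Th Xh Qh)
  (h : R) (hh : hs h)
  (nu beta gamma dt : R)
  (hnu : 0 < nu) (hbeta : 0 <= beta) (hgamma : 0 <= gamma) (hdt : 0 < dt)
  (N : nat)
  (f : R -> vfield R d -> R)
  (hf : L2_Hm1 Omega (N%:R * dt) f)
  (hfn : forall n, (n < N)%N -> Hm1 Omega (f (n.+1%:R * dt)))
  (u uhat : nat -> vfield R d) (p : nat -> 'rV[R]_d -> R)
  (halg : algorithm1 Omega (Xh h) (Qh h) nu beta gamma dt N f u uhat p) :
  nrmM Omega (u N).1 ^+ 2 + beta * nrm Omega (div (u N)) ^+ 2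
  + \sum_(0 <= n < N)
      (nrmM Omega (uhat n.+1 - u n.+1).1 ^+ 2
       + nrmM Omega (uhat n.+1 - u n).1 ^+ 2
       + beta * nrm Omega (div (u n.+1 - u n)) ^+ 2)
  + 2 * gamma * dt * \sum_(0 <= n < N) nrm Omega (div (u n.+1)) ^+ 2
  + nu * dt * \sum_(0 <= n < N) nrmM Omega (grad (uhat n.+1)) ^+ 2
  <= nrmM Omega (u 0%N).1 ^+ 2 + beta * nrm Omega (div (u 0%N)) ^+ 2
     + dt / nu * \sum_(0 <= n < N) dual_norm Omega (f (n.+1%:R * dt)) ^+ 2.
Proof.
have [_ _ [_ XH _] _ _] := hfe _ hh; have [X0 step] := halg.
have Xu n : (n <= N)%N -> Xh h (u n).
  by case: n => // n nN; have [_ []] := step n nN.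
(* Merge the three sums over the time steps on the left into one. *)
rewrite !mulr_sumr -!addrA -!big_split/= !addrA.
pose energy n := nrmM Omega (u n).1 ^+ 2 + beta * nrm Omega (div (u n)) ^+ 2.
apply: (@telescope_le _ energy) => n nN.
have [s1 s2] := step n nN.
have := step_energy hnu hdt XH (hfn _ nN) (Xu n (ltnW nN)) s1 s2.
rewrite /energy !addrA; exact.
Qed.
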